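(* For every integer $n\ge3$, $\varphi(P_n)=n$.
   Context: $P_n$ is the path on $n$ vertices. Two sets overlap if they intersect and neither is a subset of the other. An overlap representation of a graph $G=(V,E)$ is a family (multiset) of sets $\{S_v : v\in V\}$ such that for all $u,v\in V$, $(u,v)\in E$ iff $S_u\cap S_v\neq\emptyset$, $S_u\not\subseteq S_v$ and $S_v\not\subseteq S_u$; its size is $|\bigcup_{v} S_v|$, and the overlap number $\varphi(G)$ is the minimum size of an overlap representation of $G$. *)

(* Defs.v *)
From mathcomp Require Import all_boot.
From mathcomp Require Import boolp.

Set Implicit Arguments.
Unset Strict Implicit.
Unset Printing Implicit Defensive.

Record sgraph := SGraph {
  vertex :> finType;
  edge : rel vertex;
  edge_sym : symmetric edge;
  edge_irr : irreflexive edge }.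

Section PathGraph.
Variable n : nat.

Definition path_edge : rel 'I_n := fun i j => (i.+1 == j :> nat) || (j.+1 == i :> nat).

Lemma path_edge_sym : symmetric path_edge.
Proof. by move=> i j; rewrite /path_edge orbC. Qed.

Lemma path_edge_irr : irreflexive path_edge.
Proof. by move=> i; rewrite /path_edge orbb eqn_leq ltnn. Qed.

Definition path_graph : sgraph := SGraph path_edge_sym path_edge_irr.
End PathGraph.

Section Overlap.
Variable T : finType.

Definition overlap (A B : {set T}) : bool :=
  [&& A :&: B != set0, ~~ (A \subset B) & ~~ (B \subset A)].

(* A family indexed by the vertices, so that equal sets may be assigned to
   distinct vertices. *)
Definition overlap_rep (G : sgraph) (S : G -> {set T}) : Prop :=
  forall u v : G, edge u v = overlap (S u) (S v).

Definition rep_size (G : sgraph) (S : G -> {set T}) : nat :=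
  #|\bigcup_(v : G) S v|.
End Overlap.

(* The ground set ranges over all finite types and need not be covered by the
   family: only the union counts. *)
Definition has_rep_of_size (G : sgraph) (k : nat) : Prop :=
  exists (T : finType) (S : G -> {set T}), overlap_rep S /\ rep_size S = k.

(* Represent v by a private point together with the edges incident to v. *)
Lemma ex_rep_size (G : sgraph) : exists k, `[< has_rep_of_size G k >].
Proof.
pose T : finType := (G + {set G})%type.
pose S (v : G) : {set T} :=
  [set x | match x with
           | inl w => w == v
           | inr E => [exists w, edge v w && (E == [set v; w])] end].
exists (rep_size S); apply/asboolP; exists T, S; split=> // u v.
apply/idP/idP => [uv|/and3P[/set0Pn[x]]].
  have neq_uv : u != v by apply: contraTneq uv => ->; rewrite edge_irr.
  apply/and3P; split.
  - apply/set0Pn; exists (inr [set u; v]); rewrite !inE; apply/andP; split.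
      by apply/existsP; exists v; rewrite uv eqxx.
    by apply/existsP; exists u; rewrite edge_sym uv setUC eqxx.
  - apply/negP => /subsetP/(_ (inl u)); rewrite !inE eqxx (negbTE neq_uv).
    by move/(_ isT).
  - apply/negP => /subsetP/(_ (inl v)); rewrite !inE eqxx eq_sym (negbTE neq_uv).
    by move/(_ isT).
rewrite !inE; case: x => [w /andP[/eqP-> /eqP->]|E]; first by rewrite subxx.
case/andP=> /existsP[w /andP[uw /eqP->]] /existsP[z /andP[vz /eqP eqE]] nsub _.
have : v \in [set u; w] by rewrite eqE !inE eqxx.
rewrite !inE => /orP[/eqP vu|/eqP->] //.
by move: nsub; rewrite vu subxx.
Qed.

Definition overlap_number (G : sgraph) : nat := ex_minn (ex_rep_size G).

(* Main.v *)
Require Import Defs.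
From mathcomp Require Import all_boot.
From mathcomp Require Import boolp.
From mathcomp Require Import zify.

(** Upper bound: the pairs {i, i+1} for i < n-1 form a path, and the last vertex
    gets {0, ..., n-2}, which contains all pairs but the last one, and overlaps
    that one.

    Lower bound: count the cells (nonempty Venn regions, including the outer
    one) cut out by the first k sets.  Two overlapping sets have 4 cells.  Each
    further set S_k, except possibly the last one, splits a cell: otherwise S_k
    is a union of inner cells.  As S_(k+1) overlaps none of the first k sets, which
    are connected by overlaps, it either contains all of them, hence contains
    S_k, or lies in a single cell, hence is contained in or disjoint from S_k;
    both contradict that S_(k+1) overlaps S_k.  So n-1 sets cut out at least n+1
    cells, n of them inside the union. *)

Set Implicit Arguments.
Unset Strict Implicit.
Unset Printing Implicit Defensive.

Lemma overlap_sym (T : finType) (A B : {set T}) : overlap A B = overlap B A.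
Proof. by rewrite /overlap setIC [~~ (A \subset B) && _]andbC. Qed.

Lemma overlap_imset (T U : finType) (f : T -> U) (A B : {set T}) :
  injective f -> overlap (f @: A) (f @: B) = overlap A B.
Proof.
move=> f_inj; have subE (C D : {set T}) : (f @: C \subset f @: D) = (C \subset D).
  apply/idP/idP => [/subsetP sCD|]; last exact: imsetS.
  by apply/subsetP => x xC; rewrite -(mem_imset _ _ f_inj) sCD ?imset_f.
rewrite /overlap !subE -imsetI; last by move=> x y _ _; apply: f_inj.
by rewrite -!card_gt0 card_imset.
Qed.

(** * Cells of a family of sets, counted by representatives *)

Section Cells.
Variables (T : finType) (S : nat -> {set T}).

Definition same_cell (k : nat) (x y : T) : bool :=
  [forall j : 'I_k, (x \in S j) == (y \in S j)].

Lemma same_cellP (k : nat) (x y : T) :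
  reflect (forall j, j < k -> (x \in S j) = (y \in S j)) (same_cell k x y).
Proof.
apply: (iffP forallP) => [h j lt_jk|h j]; last by apply/eqP/h.
exact/eqP/(h (Ordinal lt_jk)).
Qed.

Lemma same_cell_sym (k : nat) (x y : T) : same_cell k x y = same_cell k y x.
Proof. by apply: eq_forallb => j; rewrite eq_sym. Qed.

Lemma same_cell_trans (k : nat) : transitive (same_cell k).
Proof.
by move=> y x z /same_cellP xy /same_cellP yz; apply/same_cellP => j lt_jk;
  rewrite xy ?yz.
Qed.

Lemma same_cellS (k : nat) (x y : T) :
  same_cell k.+1 x y -> same_cell k x y /\ (x \in S k) = (y \in S k).
Proof.
move=> /same_cellP h; split; last exact: h.
by apply/same_cellP => j lt_jk; apply: h; apply: ltnW.
Qed.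

(** Such an [X] is a partial system of representatives, so [#|X|] bounds the number of cells from
    below without forming the quotient. *)
Definition in_distinct_cells (k : nat) (X : {set T}) : Prop :=
  {in X &, forall x y, same_cell k x y -> x = y}.

Lemma in_distinct_cells_insert (k : nat) (X : {set T}) (w : T) :
    in_distinct_cells k X -> {in X, forall x, ~~ same_cell k.+1 w x} ->
  in_distinct_cells k.+1 (w |: X) /\ #|w |: X| = #|X|.+1.
Proof.
move=> Xcells w_new; split; last first.
  rewrite cardsU1; case: (boolP (w \in X)) => [/w_new/negP[]|//].
  exact/same_cellP.
move=> x y /setU1P[->|xX] /setU1P[->|yX] //.
- by rewrite (negbTE (w_new y yX)).
- by rewrite same_cell_sym (negbTE (w_new x xX)).
by move=> /same_cellS[+ _]; apply: Xcells.
Qed.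

(** [X] has at most one point in the cell of [y] and [z], so one of the two halves into which [S k]
    cuts this cell misses [X]; its witness [y] or [z] can be added. *)
Lemma in_distinct_cells_split (k : nat) (X : {set T}) (y z : T) :
    in_distinct_cells k X -> same_cell k y z -> y \in S k -> z \notin S k ->
  exists2 Y, in_distinct_cells k.+1 Y & #|Y| = #|X|.+1.
Proof.
move=> Xcells yz yS zS; suff [w w_new]: exists w, {in X, forall x, ~~ same_cell k.+1 w x}.
  by have [] := in_distinct_cells_insert Xcells w_new; exists (w |: X).
case: (boolP [exists x in X, same_cell k.+1 y x]) => [|/exists_inPn]; last by exists y.
move=> /exists_inP[x xX /same_cellS[yx]]; rewrite yS => xS.
exists z => x' x'X; apply/negP => /same_cellS[zx' zS'].
suff xx' : x = x' by move: zS; rewrite zS' -xx' -xS.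
apply: Xcells => //; rewrite same_cell_sym in yx.
exact: same_cell_trans yx (same_cell_trans yz zx').
Qed.

(** All points outside the union share one cell, so at most one of them is in [X]. *)
Lemma in_distinct_cells_card (k n : nat) (X : {set T}) :
  k <= n -> in_distinct_cells k X -> #|X| <= #|\bigcup_(j < n) S j|.+1.
Proof.
move=> le_kn Xcells; set A := \bigcup_(_ < _) _.
have notA x : x \notin A -> forall j, j < k -> (x \in S j) = false.
  move=> /bigcupP xA j lt_jk; apply/negP => xS; apply: xA.
  by exists (Ordinal (leq_trans lt_jk le_kn)).
rewrite -(cardsID A X) -addn1 leq_add ?subset_leq_card ?subsetIr //.
apply/card_le1_eqP => x y /setDP[xX /notA xA] /setDP[yX /notA yA].
by apply: Xcells => //; apply/same_cellP => j lt_jk; rewrite xA ?yA.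
Qed.

Lemma not_overlap_connected (m : nat) (X : {set T}) :
    (forall j, j < m -> ~~ overlap X (S j)) ->
    (forall j, j.+1 < m -> overlap (S j) (S j.+1)) ->
  (forall j, j < m -> S j \subset X) \/ {in X &, forall x y, same_cell m x y}.
Proof.
move=> novl ovl.
(* Membership in [S j] is constant on [X] once [X] misses [S j] or lies inside it; the induction
   carries this form of the second alternative. *)
suff : (forall j, j < m -> S j \subset X) \/
       (forall j, j < m -> X :&: S j = set0 \/ X \subset S j).
  case=> [|h]; [by left | right => x y xX yX].
  apply/same_cellP => j lt_jm; have [XS0|/subsetP sXS] := h j lt_jm; last by rewrite !sXS.
  have notS w : w \in X -> (w \in S j) = false.
    by move=> wX; have := in_set0 w; rewrite -XS0 inE wX.
  by rewrite !notS.
elim: m novl ovl => [|m IHm] novl ovl; first by left.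
have {IHm} IH := IHm (fun j h => novl j (ltnW h)) (fun j h => ovl j (ltnW h)).
have Sm : S m \subset X \/ (X :&: S m = set0 \/ X \subset S m).
  have := novl m (ltnSn m); rewrite /overlap.
  case: eqP => [|_] /=; first by right; left.
  by case: (X \subset S m) => /=; [right; right | rewrite negbK; left].
have extend (P : nat -> Prop) : (forall j, j < m -> P j) -> P m ->
    forall j, j < m.+1 -> P j.
  by move=> Plt Pm j; rewrite ltnS leq_eqVlt => /predU1P[->//|]; apply: Plt.
(* A single set has no predecessor to agree with, and either alternative extends. *)
case: m IH Sm extend {novl} ovl => [|m] IH Sm extend ovl.
  by case: Sm => Sm; [left | right]; apply: extend.
have /and3P[/set0Pn[a /setIP[aS aS']] nsub nsub'] := ovl m (ltnSn _).
(* In the mixed cases one of [S m] and [S m.+1] lies inside [X] and the other misses or contains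
   [X], so these two could not overlap. *)
case: IH Sm => [IH|IH] [Sm|Sm]; try by [left; apply: extend | right; apply: extend].
- have sX := IH m (ltnSn m); case: Sm => [XS0|sXS].
    by have := in_set0 a; rewrite -XS0 inE aS' (subsetP sX).
  by rewrite (subset_trans sX sXS) in nsub.
case: (IH m (ltnSn m)) => [XS0|sXS].
  by have := in_set0 a; rewrite -XS0 inE aS (subsetP Sm).
by rewrite (subset_trans Sm sXS) in nsub'.
Qed.

(** * Cells cut out by the sets of a path *)

Section Path.
Variables (n : nat) (o : T).
Hypothesis S_path : forall i j, i < n -> j < n ->
  overlap (S i) (S j) = (i.+1 == j) || (j.+1 == i).
Hypothesis oNS : forall i, o \notin S i.

Lemma path_splits_cell (k : nat) : k.+1 < n ->
  exists y z, [/\ same_cell k y z, y \in S k & z \notin S k].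
Proof.
move=> lt_kn.
case: (boolP [exists y, exists z, [&& same_cell k y z, y \in S k & z \notin S k]]).
  by move=> /existsP[y /existsP[z /and3P[? ? ?]]]; exists y, z.
move=> /existsPn nsplit.
have cellS y z : same_cell k y z -> y \in S k -> z \in S k.
  move=> yz yS; apply: contraNT (nsplit y) => zS.
  by apply/existsP; exists z; rewrite yz yS.
have /and3P[/set0Pn[a /setIP[aS aS']] /negP nsub /negP nsub'] :
  overlap (S k) (S k.+1) by rewrite S_path ?eqxx ?(ltnW lt_kn).
have [||sub|one_cell] := @not_overlap_connected k (S k.+1).
- by move=> j lt_jk; rewrite S_path; lia.
- by move=> j lt_jk; rewrite S_path; lia.
- case: nsub; apply/subsetP => y yS.
  case: (boolP [exists j : 'I_k, y \in S j]) => [/existsP[j]|/existsPn yNS].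
    exact/subsetP/sub.
  (* A point outside the first [k] sets shares the outer cell with [o], so an unsplit cell would put
     [o] into [S k]. *)
  have /cellS/(_ yS) : same_cell k y o.
    by apply/forallP => j; rewrite (negbTE (oNS j)) (negbTE (yNS j)).
  by rewrite (negbTE (oNS k)).
by case: nsub'; apply/subsetP => y yS; apply: cellS (one_cell a y aS' yS) aS.
Qed.

Lemma path_cells (k : nat) : k.+2 < n ->
  exists2 X, in_distinct_cells k.+2 X & #|X| = k.+4.
Proof.
elim: k => [|k IHk] lt_kn; last first.
  have [X Xcells cardX] := IHk (ltnW lt_kn).
  have [y [z [yz yS zS]]] := path_splits_cell lt_kn.
  by have [Y Ycells cardY] := in_distinct_cells_split Xcells yz yS zS; exists Y;
     rewrite ?cardY ?cardX.
have /and3P[/set0Pn[a /setIP[a0 a1]] /subsetPn[b b0 b1] /subsetPn[c c1 c0]] :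
  overlap (S 0) (S 1) by rewrite S_path //; lia.
have cell2 x y : same_cell 2 x y ->
    ((x \in S 0) = (y \in S 0)) * ((x \in S 1) = (y \in S 1)).
  by move=> /same_cellP h; rewrite !h.
have o0 := oNS 0; have o1 := oNS 1.
(* One point per cell of [S 0] and [S 1]: outside both, in both, only in [S 0], only in [S 1]. *)
exists [set o; a; b; c].
  move=> x y; rewrite !inE -!orbA => /or4P[] /eqP-> /or4P[] /eqP-> // /cell2 [];
  by rewrite ?a0 ?a1 ?b0 ?(negbTE b1) ?(negbTE c0) ?c1 ?(negbTE o0) ?(negbTE o1).
have neq x y (A : {set T}) : x \in A -> y \notin A -> (x == y) = false.
  by move=> xA yA; apply/negP => /eqP exy; rewrite exy (negbTE yA) in xA.
rewrite -!setUA !cardsU1 cards1 !inE !(eq_sym o).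
rewrite (neq a o _ a0) // (neq a b _ a1) // (neq a c _ a0) //.
by rewrite (neq b o _ b0) // (neq b c _ b0) // (neq c o _ c1).
Qed.

End Path.
End Cells.

Lemma path_rep_size_ge (n : nat) (T : finType) (S : path_graph n -> {set T}) :
  3 <= n -> overlap_rep S -> n <= rep_size S.
Proof.
case: n S => [|[|[|n]]] // S _ rep.
(* Moving to [option T] supplies [None] as a point outside every set, which [T] itself may lack. For
   [j] beyond the last vertex, [inord] falls back to vertex 0. *)
pose S' j : {set option T} := Some @: S (inord j).
have [||X Xcells cardX] := @path_cells _ S' n.+3 None _ _ n (ltnSn _).
- move=> i j lt_i lt_j; rewrite overlap_imset; last exact: Some_inj.
  by rewrite -rep /= /path_edge !inordK.
- by move=> i; apply/imsetP => -[].
(* With [n.+3] vertices, all sets but the last give [n.+4] representatives; discarding the outer one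
   leaves [n.+3]. *)
have := in_distinct_cells_card (leqnSn n.+2) Xcells.
rewrite cardX ltnS => /leq_trans; apply.
have Some_inj' : injective (@Some T) by move=> x y [].
rewrite /rep_size -(card_imset _ Some_inj'); apply: subset_leq_card.
apply/bigcupsP => j _; apply: imsetS; exact: bigcup_sup.
Qed.

(** * The explicit representation on [n] points *)

Definition path_rep (n : nat) (i : path_graph n) : {set 'I_n} :=
  if i.+1 == n then [set x : 'I_n | x.+1 < n]
  else [set x : 'I_n | (x == i :> nat) || (x == i.+1 :> nat)].

Lemma overlapP (T : finType) (A B : {set T}) :
  reflect [/\ exists x, x \in A /\ x \in B, exists x, x \in A /\ x \notin B
            & exists x, x \in B /\ x \notin A] (overlap A B).
Proof.
apply: (iffP and3P) => -[]; last first.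
  move=> [a [aA aB]] [b [bA bB]] [c [cB cA]]; split.
  - by apply/set0Pn; exists a; rewrite inE aA.
  - by apply/subsetPn; exists b.
  - by apply/subsetPn; exists c.
move=> /set0Pn[a /setIP[aA aB]] /subsetPn[b bA bB] /subsetPn[c cB cA].
by split; [exists a | exists b | exists c].
Qed.

Lemma path_rep_overlap (n : nat) : 3 <= n -> overlap_rep (@path_rep n).
Proof.
move=> hn.
suff le_case (u v : 'I_n) : u <= v -> (u.+1 == v) = overlap (path_rep u) (path_rep v).
  move=> u v; rewrite /= /path_edge; case: (ltngtP u v) => [lt_uv|lt_vu|/ord_inj->].
  - by rewrite -le_case; lia.
  - by rewrite overlap_sym -le_case; lia.
  - by rewrite /overlap subxx andbF; lia.
have lt_u := ltn_ord u; have lt_v := ltn_ord v; move=> le_uv.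
apply/eqP/overlapP => [uv|[[x [xu xv]] [y [yu yv]] [z [zv zu]]]]; last first.
  by move: xu xv yu yv zv zu; rewrite /path_rep;
     (do 2![case: eqP => ?]; rewrite !inE); lia.
have lt0 : 0 < n by lia.
case: (ltnP v.+1 n) => [lt_v1|le_v1].
  by split; [exists v | exists u | exists (Ordinal lt_v1)];
    rewrite /path_rep; (do 2![case: eqP => ?]; rewrite !inE /=); lia.
(* Here [v] is the last vertex and [u] is [n - 2]; the point 0 lies outside the pair of [u] because
   [3 <= n]. *)
by split; [exists u | exists v | exists (Ordinal lt0)];
  rewrite /path_rep; (do 2![case: eqP => ?]; rewrite !inE /=); lia.
Qed.

Theorem theorem14 (n : nat) (hn : 3 <= n) : overlap_number (path_graph n) = n.
Proof.
rewrite /overlap_number; case: ex_minnP => m /asboolP[T [S [rep <-]]] min_m.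
apply/eqP; rewrite eqn_leq path_rep_size_ge // andbT.
apply: leq_trans (min_m (rep_size (@path_rep n)) _) _.
  by apply/asboolP; exists 'I_n, (@path_rep n); split=> //; apply: path_rep_overlap.
by rewrite /rep_size -[X in _ <= X]card_ord max_card.
Qed.
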